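(* Let $G$ be a graph with $m(G) \ge 18$. Then there is a proper edge-colouring of $G$ such that every rainbow subgraph $H \subseteq G$ (with $v_H \ge 3$) has $2$-density strictly below $m(G)$, that is, $d_2(H) < m(G)$.
   Context: All graphs are finite and simple; $v_H$ and $e_H$ denote the numbers of vertices and edges of a graph $H$. The maximal density of a graph $G$ is \[ m(G) = \max \left\{ \frac{e_{G'}}{v_{G'}} : \emptyset \neq G' \subseteq G \right\},\] the maximum being over all subgraphs with at least one vertex. The $2$-density of a graph $H$ with $v_H \ge 3$ is $d_2(H) = \frac{e_H - 1}{v_H - 2}$. A proper edge-colouring of $G$ assigns colours to the edges (any number of colours is allowed) so that any two distinct edges sharing a vertex get different colours. A (not necessarily induced) subgraph of an edge-coloured graph is rainbow if all its edges have pairwise distinct colours. *)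

(* Defs.v *)
From HB Require Import structures.
From mathcomp Require Import all_boot all_order all_algebra.

Set Implicit Arguments.
Unset Strict Implicit.
Unset Printing Implicit Defensive.

Import Order.TTheory GRing.Theory Num.Theory.
Local Open Scope ring_scope.

Record sgraph := SGraph {
  vertex :> finType;
  adj : rel vertex;
  adj_sym : symmetric adj;
  adj_irrefl : irreflexive adj
}.

Definition edges (G : sgraph) : {set {set G}} :=
  [set [set p.1; p.2] | p : G * G & adj p.1 p.2].

(* A candidate subgraph is a pair (vertex set, edge set), so that subgraphs
   need be neither induced nor spanning. *)
Definition pregraph (G : sgraph) : finType := ({set G} * {set {set G}})%type.

Definition subgraph (G : sgraph) (H : pregraph G) : bool :=
  (H.2 \subset edges G) && [forall f in H.2, f \subset H.1].

Definition nverts (G : sgraph) (H : pregraph G) : nat := #|H.1|.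
Definition nedges (G : sgraph) (H : pregraph G) : nat := #|H.2|.

(* All the densities below are nonnegative, so the default value 0 only matters
   for the graph without vertices, whose maximal density is undefined. *)
Definition max_density (G : sgraph) : rat :=
  \big[Num.max/0]_(H : pregraph G | subgraph H && (0 < nverts H)%N)
     ((nedges H)%:R / (nverts H)%:R).

(* Used only when H has at least 3 vertices; the subtractions are in rat. *)
Definition density2 (G : sgraph) (H : pregraph G) : rat :=
  ((nedges H)%:R - 1) / ((nverts H)%:R - 2).

(* Colours are natural numbers, which are enough for a finite graph; the values
   of a colouring outside edges G are irrelevant. *)
Definition proper_edge_colouring (G : sgraph) (c : {set G} -> nat) : Prop :=
  {in edges G &, forall f g : {set G},
     f != g -> f :&: g != set0 -> c f != c g}.

Definition rainbow (G : sgraph) (c : {set G} -> nat) (H : pregraph G) : Prop :=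
  {in H.2 &, injective c}.

(* Main.v *)
Require Import Defs.
From HB Require Import structures.
From mathcomp Require Import all_boot all_order all_algebra.
From mathcomp Require Import zify ring lra.

Set Implicit Arguments.
Unset Strict Implicit.
Unset Printing Implicit Defensive.

Import Order.TTheory GRing.Theory Num.Theory.
Local Open Scope ring_scope.

(* Write [m] for the maximal density.  Give every vertex [x] a weight [t x > 0] and
   split each edge between its endpoints so that, in an edge [xy] with
   [t x <= t y], the heavier endpoint [y] owns only [t x / (2 * t y)] of it.  As no
   set spans more than [m] edges per vertex, the weights can be chosen so that
   every vertex owns at most about [m].  Colour the edges greedily in decreasing
   order of the weight of their lighter end.

   Suppose that a rainbow [F] in a vertex set [W] has at least [m (|W| - 2) + 1]
   edges.  Then the vertices of [W] own at most [2m - 1] outside [W] in total.  For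
   each level [s] the rainbow edges between vertices of [W] of weight at least [s]
   are no more numerous than the colours available there, hence than [2m] plus the
   largest degree into the vertices of weight at least [s]; such a degree counts
   neighbours in [W] of weight at least [s], and neighbours outside [W], which are
   paid for by the parts owned outside.  Integrating over [s] bounds the sum of
   [min (t x) (t y)] over the edges [xy] inside [W] from above.  But [W] owns most
   of the edges at its vertices, which bounds the same sum from below by about
   [2m/3] times the total weight of [W], a contradiction for [m >= 18].  The few
   heaviest vertices of [W] that own a lot outside [W] are discarded first. *)

(** * Splitting an edge between its endpoints *)

(* The part of an edge owned by its endpoint of weight [a], the other one having
   weight [b]. *)
Definition share (a b : rat) : rat :=
  if b <= a then b / (2 * a) else 1 - a / (2 * b).

Lemma shareD a b : 0 < a -> 0 < b -> share a b + share b a = 1.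
Proof.
move=> a0 b0; rewrite /share; case: (ltrgtP b a) => [ba|ab|->]; field; lra.
Qed.

Lemma share_ge0 a b : 0 < a -> 0 < b -> 0 <= share a b.
Proof.
move=> a0 b0; rewrite /share; case: ifP => [_|/negbT]; first by rewrite divr_ge0; lra.
by rewrite -ltNge subr_ge0 ler_pdivrMr; lra.
Qed.

Lemma share_ge_half a b : 0 < a -> a <= b -> 2^-1 <= share a b.
Proof.
move=> a0 ab; have b0 : 0 < b by lra.
rewrite /share; case: ifP => [ba|_].
  by rewrite ler_pdivlMr; lra.
by rewrite lerBrDr -lerBrDl ler_pdivrMr; lra.
Qed.

Lemma share_homo a b b' : 0 < a -> 0 < b -> b <= b' -> share a b <= share a b'.
Proof.
move=> a0 b0 bb; have b'0 : 0 < b' by lra.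
rewrite /share; case: ifP => [ba|/negbT]; case: ifP => [b'a|/negbT]; rewrite -?ltNge.
- by move=> *; rewrite ler_pM2r // invr_gt0; lra.
- move=> ab'; apply: (@le_trans _ _ 2^-1); first by rewrite ler_pdivrMr; lra.
  by rewrite lerBrDr -lerBrDl ler_pdivrMr; lra.
- by move=> ab; lra.
- by move=> _ _; rewrite lerD2l lerN2 ler_pM2l // lef_pV2 ?posrE; lra.
Qed.

(** Scaling [a] by [q] scales a term at most 1/2 by [q] or [q^-1]. If [q * a] overtakes [b], the
    terms before and after are both at least [q^-1 / 2], so the loss is at most
    [1 - q^-1 <= q - 1]. *)
Lemma share_drop a b q : 0 < a -> 0 < b -> 1 <= q ->
  share a b - (q - 1) <= share (q * a) b.
Proof.
move=> a0 b0 q1; have qa : 0 < q * a by rewrite mulr_gt0; lra.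
have aqa : a <= q * a by nra.
have q0 : q != 0 by lra.
have bq : b / (2 * (q * a)) = b / (2 * a) * q^-1 by field; lra.
have q'1 : q^-1 <= 1 by rewrite invf_le1; lra.
have qK : q * q^-1 = 1 by rewrite divff.
have q'2 : 2 - q <= q^-1 by nra.
have half (x y : rat) : 0 < x -> 0 < y -> x <= y -> x / (2 * y) <= 2^-1.
  by move=> *; rewrite ler_pdivrMr; lra.
have ge0 (x y : rat) : 0 < x -> 0 < y -> 0 <= x / (2 * y).
  by move=> *; rewrite divr_ge0; lra.
rewrite /share; case: ifP => [ba|/negbT]; last rewrite -ltNge => ab.
- rewrite ifT; last lra.
  rewrite bq; have := half _ _ b0 a0 ba; have := ge0 _ _ b0 a0; nra.
- case: ifP => [bqa|/negbT]; last rewrite -ltNge => qab.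
  + have h1 : q^-1 / 2 <= a / (2 * b).
      by rewrite ler_pdivlMr ?mulr_gt0 // mulrC -ler_pdivlMr ?divr_gt0 ?invr_gt0 //; [
         rewrite invfM !invrK; lra | lra].
    have h2 : q^-1 / 2 <= b / (2 * (q * a)).
      rewrite bq -[X in X <= _]mulrC ler_pM2r ?invr_gt0; last lra.
      by rewrite ler_pdivlMr; lra.
    lra.
  + have -> : q * a / (2 * b) = a / (2 * b) * q by field; lra.
    have := half _ _ a0 b0 (ltW ab); have := ge0 _ _ a0 b0; nra.
Qed.

Lemma min_le_share a b : 0 < a -> 0 < b -> Num.min a b <= 2 * a * share a b.
Proof.
move=> a0 b0; rewrite minC /share; case: (leP b a) => [ba|ab] /=.
  by have -> : 2 * a * (b / (2 * a)) = b by field; lra.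
have := share_ge_half a0 (ltW ab); rewrite /share (lt_geF ab); nra.
Qed.

(** If [a <= b], the part of [b] weighs exactly [a / 2] and that of [a] at most [a]. This turns
    ownership into a lower bound for sums of minima. *)
Lemma wshareD_le a b : 0 < a -> 0 < b ->
  a * share a b + b * share b a <= 3 / 2 * Num.min a b.
Proof.
wlog ab : a b / a <= b => [W a0 b0|a0 b0].
  have /orP[ab|ba] := le_total a b; first exact: W.
  by rewrite minC addrC; apply: W.
have sb : share b a = a / (2 * b) by rewrite /share ab.
have -> : share a b = 1 - a / (2 * b) by rewrite -sb; have := shareD a0 b0; lra.
have -> : b * share b a = a / 2 by rewrite sb; field; lra.
have : 0 <= a / (2 * b) by rewrite divr_ge0; lra.
have : a / (2 * b) <= 2^-1 by rewrite ler_pdivrMr; lra.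
by rewrite min_l //; nra.
Qed.

(** * Double counting of the edges inside a vertex set *)

Lemma sum_adj_sym (G : sgraph) (A : {set G}) (F : G -> G -> rat) :
  \sum_(x in A) \sum_(y in A | adj x y) F x y =
  \sum_(x in A) \sum_(y in A | adj x y) F y x.
Proof.
rewrite (exchange_big_dep (mem A)) /=; last by move=> x y _ /andP[].
by apply: eq_bigr => y Ay; apply: eq_bigl => x; rewrite Ay /= adj_sym.
Qed.

Lemma sum_share (G : sgraph) (A : {set G}) (t : G -> rat) : (forall x, 0 < t x) ->
  \sum_(x in A) \sum_(y in A | adj x y) share (t x) (t y) =
  (\sum_(x in A) \sum_(y in A | adj x y) 1) / 2.
Proof.
move=> t0; set S := LHS; have : S + S = \sum_(x in A) \sum_(y in A | adj x y) 1.
  rewrite {2}/S sum_adj_sym -big_split; apply: eq_bigr => x _ /=.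
  by rewrite -big_split; apply: eq_bigr => y _; rewrite /= shareD.
by move=> <-; lra.
Qed.

Lemma card_edges_in (G : sgraph) (A : {set G}) :
  \sum_(x in A) \sum_(y in A | adj x y) (1 : rat) =
  2 * #|[set e in edges G | e \subset A]|%:R.
Proof.
rewrite pair_big_dep /=; set P := [set p : G * G | (p.1 \in A) && ((p.2 \in A) && adj p.1 p.2)].
transitivity (#|P|%:R : rat).
  by rewrite sumr_const; congr (_%:R); apply: eq_card => p; rewrite inE.
set f := fun p : G * G => [set p.1; p.2].
have -> : [set e in edges G | e \subset A] = f @: P.
  apply/setP => e; rewrite inE; apply/andP/imsetP => [[/imsetP[p adjp ->]]|[p]].
    by rewrite inE in adjp; rewrite subUset !sub1set => /andP[p1 p2]; exists p; rewrite // inE p1 p2.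
  rewrite inE => /and3P[p1 p2 adjp] ->; split; last by rewrite subUset !sub1set p1.
  by apply/imsetP; exists p; rewrite // inE.
rewrite -(natrM _ 2) -sum1_card (partition_big_imset f) /= mulnC -sum_nat_const.
congr (_%:R); apply: eq_bigr => e /imsetP[[x y]].
rewrite inE /= => /and3P[xA yA xy] ->; rewrite sum1dep_card.
have ne : (x, y) != (y, x).
  by apply: contraTneq xy => -[-> _]; rewrite adj_irrefl.
have -> : [set p in P | f p == f (x, y)] = [set (x, y); (y, x)]; last by rewrite cards2 ne.
apply/setP => -[u v]; rewrite !inE /= /f /=; apply/andP/orP.
  move=> [/and3P[_ _ uv] /eqP E].
  have : u \in [set x; y] by rewrite -E !inE eqxx.
  have : v \in [set x; y] by rewrite -E !inE eqxx orbT.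
  rewrite !inE => /orP[]/eqP vE /orP[]/eqP uE; move: uv; rewrite uE vE ?adj_irrefl //.
    by right.
  by left.
move=> [] /eqP[-> ->]; first by rewrite xA yA xy eqxx.
by rewrite xA yA adj_sym xy setUC eqxx.
Qed.

(** * Weights under which every load is at most about [m] *)

Lemma bernoulli (k : rat) n : 0 <= k -> 1 + k * n%:R <= (1 + k) ^+ n.
Proof.
move=> k0; elim: n => [|n IH]; first by rewrite expr0; lra.
have n0 : 0 <= n%:R :> rat by [].
rewrite exprS -natr1; nra.
Qed.

(** The share decays geometrically in the gap [j - i], so an edge contributes a bounded amount to
    all the levels it crosses together. *)
Lemma gap_share (k : rat) i j : 0 < k -> (i <= j)%N ->
  (j - i)%:R * share ((1 + k) ^+ j) ((1 + k) ^+ i) <= (2 * k)^-1.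
Proof.
move=> k0 ij; rewrite -{2}(subnK ij) exprD.
have q0 : 0 < 1 + k by lra.
set p := (1 + k) ^+ i; have p0 : 0 < p by rewrite exprn_gt0.
have r1 := bernoulli (j - i) (ltW k0); set d := (j - i)%:R in r1 *.
have d0 : 0 <= d by [].
set r := (1 + k) ^+ (j - i) in r1 *; have rge1 : 1 <= r by nra.
have -> : share (r * p) p = (2 * r)^-1.
  by rewrite /share ifT; [field; rewrite ?gt_eqF //; lra | nra].
rewrite -ler_pdivlMr ?invr_gt0 ?invrK; last lra.
rewrite -(mulrC (2 * r)) ler_pdivlMr; last lra.
nra.
Qed.

Lemma card_ord_interval B i j : (#|[set l : 'I_B | i <= l < j]| <= j - i)%N.
Proof.
rewrite -[X in (_ <= X)%N](size_iota i) cardE -(size_map val).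
apply: uniq_leq_size; first by rewrite (map_inj_uniq val_inj) enum_uniq.
by move=> k /mapP[l]; rewrite mem_enum inE => lij -> /=; rewrite mem_iota; lia.
Qed.

(* The weights are found among the integer powers of a ratio [q] close to 1:
   exponents are raised as long as some load is too large.  A raised vertex keeps
   a load at least [m + eps / 2], so if an exponent reached the bound, then at
   every level the vertices above it would span too many edges unless they own
   much of the edges going down, which few levels allow. *)
Lemma exists_levels (G : sgraph) (m eps : rat) : 0 < eps ->
  (forall W : {set G},
     \sum_(x in W) \sum_(y in W | adj x y) 1 <= 2 * m * #|W|%:R) ->
  exists (q : rat) (n : G -> nat), 1 < q /\
    forall y, \sum_(x | adj y x) share (q ^+ n y) (q ^+ n x) <= m + eps.
Proof.
move=> eps0 sparse; set v : rat := #|G|%:R; have v0 : 0 <= v by [].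
(* Raising one exponent costs its vertex at most [k] per edge, hence at most [v * k <= eps / 2] in
   all. *)
set k := eps / (2 * (v + 1)); have k0 : 0 < k by rewrite divr_gt0 //; lra.
have kv : v * k <= eps / 2.
  by rewrite mulrCA ler_pM2l // ler_pdivrMr; lra.
set q := 1 + k; have q0 : 0 < q by rewrite /q; lra.
have qn0 i : 0 < q ^+ i by rewrite exprn_gt0.
(* Each level carries at least [eps / 2] of downward shares, while an ordered pair contributes at
   most [(2 * k)^-1] over all levels; so more than [X] levels are too many. *)
set X := v * v / (eps * k).
have ek0 : 0 < eps * k by rewrite mulr_gt0.
have X0 : 0 <= X by apply: divr_ge0; [exact: mulr_ge0 | exact: ltW].
set B := Num.bound X; have BX : X < B%:R by apply: archi_boundP.
pose load (n : {ffun G -> 'I_B.+1}) y := \sum_(x | adj y x) share (q ^+ n y) (q ^+ n x).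
pose good (n : {ffun G -> 'I_B.+1}) :=
  [forall y, (0 < n y)%N ==> (m + eps / 2 <= load n y)].
have good0 : good [ffun=> ord0] by apply/forallP => y; rewrite ffunE.
case: (@arg_maxnP _ [ffun=> ord0] good (fun n => \sum_x n x)%N good0) => n gn maxn.
have {}gn y : (0 < n y)%N -> m + eps / 2 <= load n y.
  by move=> ny; have /forallP/(_ y) := gn; rewrite ny.
exists q, (fun x => nat_of_ord (n x)); split; first by rewrite /q; lra.
move=> y; rewrite leNgt; apply/negP => big_y.
have [ltB|geB] := ltnP (n y) B.
  pose n' := [ffun x => if x == y then inord (n y).+1 else n x] : {ffun G -> 'I_B.+1}.
  have n'y : n' y = (n y).+1 :> nat by rewrite ffunE eqxx inordK.
  have n'x x : x != y -> n' x = n x by rewrite ffunE => /negbTE->.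
  suff gn' : good n'.
    have := maxn _ gn'; rewrite /= (bigD1 y) //= [X in (_ <= X)%N](bigD1 y) //= n'y.
    have -> : (\sum_(x | x != y) n' x = \sum_(x | x != y) n x)%N by apply: eq_bigr => x /n'x->.
    by rewrite leq_add2r ltnn.
  apply/forallP => z; apply/implyP; have [->|zy] := eqVneq z y => nz.
    apply: (@le_trans _ _ (load n y - v * k)); first by rewrite /load; lra.
    apply: (@le_trans _ _ (\sum_(x | adj y x) (share (q ^+ n y) (q ^+ n x) - k))).
      rewrite big_split /= lerD2l sumr_const mulNrn lerN2 -mulr_natl.
      rewrite ler_wpM2r ?(ltW k0) // ler_nat; exact: max_card.
    apply: ler_sum => x yx; have xy : x != y by apply: contraTneq yx => ->; rewrite adj_irrefl.
    rewrite n'y n'x // exprS; have -> : k = q - 1 by rewrite /q; lra.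
    by apply: share_drop => //; rewrite /q; lra.
  rewrite n'x // in nz; apply: (le_trans (gn _ nz)); rewrite /load n'x //.
  apply: ler_sum => x _; apply: share_homo => //.
  have [->|/n'x-> //] := eqVneq x y.
  by rewrite n'y exprS ler_peMl ?(ltW (qn0 _)) // /q; lra.
have nyB : n y = B :> nat by apply/eqP; rewrite eqn_leq geB -ltnS ltn_ord.
pose cross l z x := if [&& adj z x, (l < n z)%N & (n x <= l)%N]
  then share (q ^+ n z) (q ^+ n x) else 0.
have level (l : 'I_B) : eps / 2 <= \sum_z \sum_x cross l z x.
  pose W := [set z | (l < n z)%N].
  have W1 : 1 <= #|W|%:R :> rat.
    by rewrite ler1n card_gt0; apply/set0Pn; exists y; rewrite inE nyB.
  have loadW : (m + eps / 2) * #|W|%:R <= \sum_(z in W) load n z.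
    rewrite mulr_natr -sumr_const; apply: ler_sum => z; rewrite inE => lz.
    by apply: gn; apply: leq_ltn_trans lz.
  have E : \sum_(z in W) load n z =
     \sum_(z in W) \sum_(x in W | adj z x) share (q ^+ n z) (q ^+ n x) +
     \sum_z \sum_x cross l z x.
    rewrite [X in _ + X](bigID (mem W)) /= [X in _ + (_ + X)]big1 ?addr0; last first.
      move=> z; rewrite inE => /negbTE zW; apply: big1 => x _.
      by rewrite /cross zW andbF.
    rewrite -big_split; apply: eq_bigr => z; rewrite inE /= => lz.
    rewrite /load (bigID (mem W)) /=; congr (_ + _); first by apply: eq_bigl => x; rewrite andbC.
    rewrite -big_mkcond; apply: eq_bigl => x.
    by rewrite lz inE -leqNgt.
  (* The shares inside [W] sum to at most [m] per vertex, so the excess of the loads comes from the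
     edges leaving [W]. *)
  have := sparse W; rewrite E sum_share // in loadW.
  set S := \sum_(x in W) _ in loadW *; set C := \sum_z _ in loadW *; nra.
have : B%:R * (eps / 2) <= v * v * (2 * k)^-1.
  have -> : B%:R * (eps / 2) = \sum_(l < B) eps / 2 by rewrite sumr_const card_ord mulr_natl.
  apply: (@le_trans _ _ (\sum_(l < B) \sum_z \sum_x cross l z x)).
    by apply: ler_sum => l _; apply: level.
  rewrite exchange_big /=.
  apply: (@le_trans _ _ (\sum_(z : G) \sum_(x : G) (2 * k)^-1)); last first.
    by rewrite !sumr_const -mulrnA -[_ *+ (_ * _)]mulr_natl natrM.
  apply: ler_sum => z _; rewrite exchange_big /=; apply: ler_sum => x _.
  rewrite -big_mkcond /=.
  have [zx|zx] := leqP (n z) (n x).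
    rewrite big_pred0 ?invr_ge0; first by lra.
    by move=> l; apply/negP => /and3P[_ h1 h2]; have := leq_trans zx h2; rewrite leqNgt h1.
  apply: le_trans (gap_share k0 (ltnW zx)).
  rewrite sumr_const -[X in X <= _]mulr_natl ler_wpM2r ?share_ge0 ?ler_nat //.
  apply: leq_trans (card_ord_interval B (n x) (n z)); apply/subset_leq_card/subsetP => l.
  by rewrite !inE => /and3P[_ -> ->].
rewrite /X ltr_pdivrMr in BX; last by rewrite mulr_gt0.
set a := (2 * k)^-1; have : a * (2 * k) = 1 by rewrite mulVf //; lra.
have a0 : 0 < a by rewrite invr_gt0; lra.
have := v0; nra.
Qed.

(** * Greedy colouring by levels *)

(** The element of largest [key] is coloured last: all its conflicts then count against its [bound],
    so a colour below [bound] is free. *)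
Lemma greedy_colouring (T : finType) (S : {set T}) (conf : rel T) (key bound : T -> nat) :
  symmetric conf ->
  {in S, forall e,
    (#|[set e' in S | [&& e' != e, conf e e' & key e' <= key e]]| < bound e)%N} ->
  exists c : T -> nat, {in S &, forall e e', e != e' -> conf e e' -> c e != c e'} /\
    {in S, forall e, (c e < bound e)%N}.
Proof.
move=> csym; have [k] := ubnP #|S|; elim: k S => // k IH S Sk few.
have [->|/set0Pn[e0 Se0]] := eqVneq S set0.
  by exists (fun=> 0%N); split=> [e e'|e]; rewrite inE.
have [e Se maxe] := arg_maxnP key Se0; have {}Se : e \in S by [].
have [|f Sf|c [cP cB]] := IH (S :\ e).
- by rewrite (cardsD1 e) Se in Sk.
- apply: leq_ltn_trans (few f _); last by case/setD1P: Sf.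
  by apply/subset_leq_card/subsetP => g; rewrite !inE => /andP[/andP[_ ->]].
pose C := [set g in S | [&& g != e, conf e g & key g <= key e]]%N.
have [i iC ib] : exists2 i, i \notin [seq c g | g in C] & (i < bound e)%N.
  have /subsetPn[i _ iC] : ~~ ([set: 'I_(bound e)] \subset [pred i | val i \in [seq c g | g in C]]).
    apply: contraL (few e Se) => /subsetP sub; rewrite -leqNgt -/C.
    rewrite -[bound e]card_ord -cardsT cardE -(size_map val) cardE -(size_map c).
    apply: uniq_leq_size; first by rewrite (map_inj_uniq val_inj) enum_uniq.
    by move=> _ /mapP[j _ ->]; apply: sub; rewrite inE.
  by exists (val i); [exact: iC | exact: ltn_ord].
have new g : g \in S -> g != e -> conf e g -> c g != i.
  move=> Sg ge eg; apply: contraNneq iC => <-; apply: image_f.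
  by rewrite inE Sg ge eg; apply: maxe.
exists (fun g => if g == e then i else c g); split=> [f g Sf Sg fg fgc|f Sf].
  have [fe|fe] := eqVneq f e; have [ge|ge] := eqVneq g e.
  - by rewrite fe ge eqxx in fg.
  - by rewrite eq_sym new // -fe.
  - by rewrite new // csym -ge.
  - by apply: cP; rewrite // !inE ?fe ?ge.
have [->//|fe] := eqVneq f e.
by apply: cB; rewrite !inE fe.
Qed.

Definition updeg (G : sgraph) (n : G -> nat) (k : nat) (x : G) : nat :=
  #|[set u | adj x u & (k <= n u)%N]|.

Lemma edge_ofP (G : sgraph) (e : {set G}) :
  reflect (exists x y, adj x y /\ e = [set x; y]) (e \in edges G).
Proof.
apply: (iffP imsetP) => [[[x y]]|[x [y [xy ->]]]].
  by rewrite inE /= => xy ->; exists x, y.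
by exists (x, y); rewrite // inE.
Qed.

Lemma edge_ofW (G : sgraph) (n : G -> nat) (e : {set G}) : e \in edges G ->
  exists x y, [/\ adj x y, (n x <= n y)%N & e = [set x; y]].
Proof.
move=> /edge_ofP[x [y [xy ->]]]; have [le|/ltnW le] := leqP (n x) (n y).
  by exists x, y.
by exists y, x; rewrite adj_sym setUC.
Qed.

Lemma exists_level_colouring (G : sgraph) (n : G -> nat) :
  exists c : {set G} -> nat, proper_edge_colouring c /\
    forall x y, adj x y -> (n x <= n y)%N ->
      (c [set x; y] < updeg n (n x) x + updeg n (n x) y)%N.
Proof.
pose N := (\max_x n x)%N; have leN x : (n x <= N)%N by apply: leq_bigmax.
(* Small keys are coloured first, so the exponents are reversed; the key of an edge comes from its
   lighter end. *)
pose key (e : {set G}) := (\max_(x in e) (N - n x))%N.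
pose bound (e : {set G}) := (\sum_(z in e) #|[set u | adj z u & (N - n u <= key e)%N]|)%N.
have keyE x y : (n x <= n y)%N -> key [set x; y] = (N - n x)%N.
  move=> xy; apply/eqP; rewrite eqn_leq; apply/andP; split.
    by apply/bigmax_leqP => z; rewrite !inE => /orP[]/eqP-> //; rewrite leq_sub2l.
  by apply: leq_bigmax_cond; rewrite !inE eqxx.
have levE x u : (N - n u <= N - n x)%N = (n x <= n u)%N.
  by have := leN x; have := leN u; lia.
have boundE x y : adj x y -> (n x <= n y)%N ->
    bound [set x; y] = (updeg n (n x) x + updeg n (n x) y)%N.
  move=> xy le; have nxy : x \notin [set y].
    by rewrite inE; apply: contraTneq xy => ->; rewrite adj_irrefl.
  rewrite /bound big_setU1 //= big_set1 keyE //.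
  by congr (_ + _)%N; apply: eq_card => u; rewrite !inE levE.
have csym : symmetric (fun e f : {set G} => e :&: f != set0) by move=> e f; rewrite setIC.
have [e Ee|c [cP cB]] := greedy_colouring csym (S := edges G) (key := key) (bound := bound).
  have [x [y [xy le eE]]] := edge_ofW n Ee.
  rewrite [bound e](_ : _ = updeg n (n x) x + updeg n (n x) y)%N; last by rewrite eE boundE.
  pose U z := [set u | adj z u & (n x <= n u)%N].
  (* The conflicts of [e] form stars at [x] and [y] without [e] itself; leaving [x] out of [U y]
     gives the strict inequality. *)
  apply: (@leq_ltn_trans #|[set [set x; u] | u in U x :\ y] :|: [set [set y; u] | u in U y :\ x]|).
    apply/subset_leq_card/subsetP => f; rewrite !inE => /and4P[/edge_ofP[a [b [ab fE]]] fe fI].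
    rewrite eE keyE // => /bigmax_leqP kf.
    have na : (n x <= n a)%N by rewrite -levE; apply: kf; rewrite fE !inE eqxx.
    have nb : (n x <= n b)%N by rewrite -levE; apply: kf; rewrite fE !inE eqxx orbT.
    have star z w u : e = [set z; w] -> adj z u -> (n x <= n u)%N -> f = [set z; u] ->
        f \in [set [set z; u] | u in U z :\ w].
      move=> zw zu nu fzu; apply/imsetP; exists u => //; rewrite !inE zu nu !andbT.
      by apply: contraNneq fe => uw; rewrite fzu uw zw.
    have eE' : e = [set y; x] by rewrite setUC.
    have fE' : f = [set b; a] by rewrite setUC.
    have ba : adj b a by rewrite adj_sym.
    case/set0Pn: fI => z /setIP[ze zf].
    have : z \in [set a; b] by rewrite -fE.
    have : z \in [set x; y] by rewrite -eE.
    rewrite !inE => /orP[]/eqP-> /orP[]/eqP zE; rewrite -zE in fE fE' ab ba; apply/orP.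
    - by left; apply: star eE ab nb fE.
    - by left; apply: star eE ba na fE'.
    - by right; apply: star eE' ab nb fE.
    - by right; apply: star eE' ba na fE'.
  rewrite cardsU; apply: leq_ltn_trans (leq_subr _ _) _.
  rewrite -addnS leq_add //.
    by apply: leq_trans (leq_imset_card _ _) _; apply/subset_leq_card/subD1set.
  have xUy : x \in U y by rewrite inE adj_sym xy leqnn.
  rewrite [X in (_ <= X)%N](_ : _ = #|U y|) // (cardsD1 x (U y)) xUy.
  exact: leq_imset_card.
exists c; split=> [e f Ee Ef ef I|x y xy le]; first exact: cP.
by rewrite -boundE // cB //; apply/edge_ofP; exists x, y.
Qed.

(** * Counting rainbow edges level by level and integrating *)

(* The layers of [q ^+ n]: the sum of [jump q k] over [k <= n] is [q ^+ n]. *)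
Definition jump (q : rat) (k : nat) : rat := if k is k'.+1 then q ^+ k - q ^+ k' else 1.

Lemma jump_ge0 (q : rat) k : 1 <= q -> 0 <= jump q k.
Proof. by case: k => [|k] q1 //=; rewrite subr_ge0 ler_weXn2l. Qed.

Lemma sum_jump (q : rat) j : \sum_(k < j.+1) jump q k = q ^+ j.
Proof.
elim: j => [|j IH]; first by rewrite big_ord1 expr0.
by rewrite big_ord_recr /= IH addrC subrK.
Qed.

Lemma layer_cake (T : finType) (P : pred T) (f : T -> nat) (v : T -> rat) (q : rat) N :
  (forall x, P x -> (f x <= N)%N) ->
  \sum_(k < N.+1) jump q k * \sum_(x | P x && (k <= f x)%N) v x =
  \sum_(x | P x) v x * q ^+ f x.
Proof.
move=> fN; under eq_bigr do rewrite mulr_sumr big_mkcondr.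
rewrite exchange_big; apply: eq_bigr => x Px /=.
rewrite -sum_jump mulr_sumr (@big_ord_widen _ _ _ (f x).+1 N.+1 (fun k => v x * jump q k)).
  by rewrite [RHS]big_mkcond; apply: eq_bigr => k _; rewrite mulrC.
by rewrite ltnS fN.
Qed.

Lemma card_rainbow_le (T : finType) (c : T -> nat) (F : {set T}) M :
  {in F &, injective c} -> {in F, forall e, (c e < M)%N} -> (#|F| <= M)%N.
Proof.
move=> inj cM; rewrite cardE -(size_map c) -[M]subn0 -(size_iota 0 (M - 0)).
apply: uniq_leq_size => [|_ /mapP[e Fe ->]].
  rewrite map_inj_in_uniq ?enum_uniq // => e f; rewrite !mem_enum; exact: inj.
by rewrite mem_iota subn0 cM // -mem_enum.
Qed.

(** A rainbow edge inside level [k] has a colour below [U] plus the level degree of its heavier end,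
    so such edges are few; the other edges of the level lie inside [W] but outside [F]. *)
Lemma card_edges_level (G : sgraph) (n : G -> nat) (c : {set G} -> nat)
    (W W0 : {set G}) (F : {set {set G}}) (U k : nat) :
  (forall x y, adj x y -> (n x <= n y)%N ->
      (c [set x; y] < updeg n (n x) x + updeg n (n x) y)%N) ->
  (forall x, updeg n (n x) x <= U)%N ->
  F \subset [set e in edges G | e \subset W] -> {in F &, injective c} ->
  W0 \subset W ->
  (#|[set e in edges G | e \subset [set x in W0 | (k <= n x)%N]]| + #|F| <=
   #|[set e in edges G | e \subset W]| +
   (U + (#|[set x in W0 | (k <= n x)%N]| + #|W :\: W0| +
     \sum_(y in W0 | (k <= n y)%N) #|[set u | [&& adj y u, u \notin W & (k <= n u)%N]]|)))%N.
Proof.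
move=> cP upU FW inj W0W.
set Wk := [set x in W0 | _]; set Ek := [set e in edges G | e \subset Wk].
set E := [set e in edges G | e \subset W]; set M := (#|Wk| + _ + _)%N.
have EkE : Ek \subset E.
  apply/subsetP => e; rewrite !inE => /andP[-> eW] /=; apply: subset_trans eW _.
  by apply: subset_trans W0W; apply/subsetP => x; rewrite inE => /andP[].
have degM y : y \in Wk -> (updeg n k y <= M)%N.
  rewrite inE => /andP[W0y ky].
  apply: (@leq_trans (#|Wk| + #|W :\: W0| + #|[set u | [&& adj y u, u \notin W & (k <= n u)%N]]|)).
    rewrite -addnA; apply: leq_trans (leq_add (leqnn _) (leq_card_setU _ _)).
    apply: leq_trans (leq_card_setU _ _); apply/subset_leq_card/subsetP => u.
    by rewrite !inE => /andP[-> ->]; case: (u \in W0) => //=; case: (u \in W).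
  (* The outside degree of one vertex is bounded by the sum over all of [Wk], which can be
     integrated over the levels. *)
  by rewrite leq_add2l (bigD1 y) /= ?W0y // leq_addr.
have rain : (#|Ek :&: F| <= U + M)%N.
  apply: (@card_rainbow_le _ c); first by move=> e f /setIP[_ eF] /setIP[_]; apply: inj.
  move=> e /setIP[]; rewrite inE => /andP[/(edge_ofW n)[x [y [xy le ->]]]].
  rewrite subUset !sub1set => /andP[xW yW] _.
  apply: leq_trans (cP _ _ xy le) _; rewrite leq_add //.
  apply: leq_trans (degM _ yW); apply/subset_leq_card/subsetP => u.
  rewrite !inE => /andP[-> xu] /=; apply: leq_trans xu.
  by move: xW; rewrite inE => /andP[].
have : (#|Ek :|: F| <= #|E|)%N by rewrite subset_leq_card // subUset EkE.
have := cardsUI Ek F; lia.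
Qed.

Lemma exprn_min (q : rat) i j : 1 <= q -> q ^+ minn i j = Num.min (q ^+ i) (q ^+ j).
Proof.
move=> q1; have [ij|/ltnW ij] := leqP i j.
  by rewrite min_l // ler_weXn2l.
by rewrite min_r // ler_weXn2l.
Qed.

(** An edge is in level [k] when [k] is at most both exponents, so integration gives it the weight
    of its lighter end; it occurs as two ordered pairs, hence the half. *)
Lemma arcs_level (G : sgraph) (n : G -> nat) (A : {set G}) (q : rat) N :
  1 <= q -> {in A, forall x, (n x <= N)%N} ->
  \sum_(k < N.+1) jump q k *
     #|[set e in edges G | e \subset [set x in A | (k <= n x)%N]]|%:R =
  (\sum_(x in A) \sum_(y in A | adj x y) Num.min (q ^+ n x) (q ^+ n y)) / 2.
Proof.
move=> q1 AN.
have E (k : nat) : #|[set e in edges G | e \subset [set x in A | (k <= n x)%N]]|%:R =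
   (\sum_(p : G * G | [&& p.1 \in A, p.2 \in A & adj p.1 p.2] && (k <= minn (n p.1) (n p.2))%N) 1) / 2 :> rat.
  have := card_edges_in [set x in A | (k <= n x)%N]; rewrite pair_big_dep /= => H.
  rewrite -[LHS](@mulKf _ 2) // -H mulrC; congr (_ * _); apply: eq_bigl => -[x y] /=.
  rewrite !inE leq_min; case: (x \in A) => //=; case: (y \in A); rewrite ?andbF //=.
  by case: (adj x y); rewrite ?andbF ?andbT.
under eq_bigr do rewrite E mulrA.
rewrite -mulr_suml layer_cake.
  rewrite pair_big_dep /=; congr (_ / _); apply: eq_bigr => p _.
  by rewrite mul1r exprn_min.
by move=> p /and3P[p1 _ _]; rewrite geq_min AN.
Qed.

Lemma leak_level (G : sgraph) (n : G -> nat) (A W : {set G}) (q : rat) N :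
  1 <= q -> {in A, forall x, (n x <= N)%N} ->
  \sum_(k < N.+1) jump q k *
     (\sum_(y in A | (k <= n y)%N) #|[set u | [&& adj y u, u \notin W & (k <= n u)%N]]|)%:R =
  \sum_(y in A) \sum_(u | adj y u && (u \notin W)) Num.min (q ^+ n y) (q ^+ n u).
Proof.
move=> q1 AN.
have E (k : nat) :
   (\sum_(y in A | (k <= n y)%N) #|[set u | [&& adj y u, u \notin W & (k <= n u)%N]]|)%:R =
   \sum_(p : G * G | [&& p.1 \in A, adj p.1 p.2 & p.2 \notin W] &&
      (k <= minn (n p.1) (n p.2))%N) 1 :> rat.
  rewrite natr_sum; transitivity (\sum_(y in A | (k <= n y)%N)
     \sum_(u | [&& adj y u, u \notin W & (k <= n u)%N]) (1 : rat)).
    by apply: eq_bigr => y _; rewrite sumr_const; congr (_%:R); apply: eq_card => u; rewrite inE.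
  rewrite pair_big_dep /=; apply: eq_bigl => -[x y] /=; rewrite leq_min.
  by case: (x \in A); case: (adj x y); case: (y \in W); rewrite //= ?andbF.
under eq_bigr do rewrite E.
rewrite layer_cake.
  rewrite pair_big_dep /=; apply: eq_big => [p|p _]; first by rewrite andbA.
  by rewrite mul1r exprn_min.
by move=> p /and3P[p1 _ _]; rewrite geq_min AN.
Qed.

Lemma card_level (G : sgraph) (n : G -> nat) (A : {set G}) (q : rat) N :
  {in A, forall x, (n x <= N)%N} ->
  \sum_(k < N.+1) jump q k * #|[set x in A | (k <= n x)%N]|%:R = \sum_(x in A) q ^+ n x.
Proof.
move=> AN; transitivity (\sum_(x in A) 1 * q ^+ n x); last by under eq_bigr do rewrite mul1r.
rewrite -(layer_cake _ _ AN); apply: eq_bigr => k _.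
by rewrite sumr_const; congr (_ * _%:R); apply: eq_card => x; rewrite inE.
Qed.

(** * The contradiction for a dense rainbow subgraph *)

(* The numerical end of the proof of [rainbow_sparse], with its notation: [t] is the
   weight of the top vertex kept, [a] what it lacks, [d] the number of vertices
   discarded, and [A], [B] what the kept and the discarded vertices lack. *)
Lemma balance_absurd (m m' t T A B Th L a f U : rat) (d : nat) :
  18 <= m -> m <= m' -> m' <= m + 1 / 2 -> 0 < t ->
  T / 2 <= (f + U + d%:R) * t + Th + L -> L <= 2 * t * A ->
  (m' - d%:R) * Th - A * t <= 3 / 4 * T ->
  t * (1 + 2 * (m' - a - d%:R)) <= Th ->
  0 <= f -> 0 <= A -> f + A + B <= 2 * m - 1 / 2 -> U <= 2 * m' ->
  a <= 2 / 3 * m -> 2 / 3 * m * d%:R <= B -> False.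
Proof.
move=> m18 mm' m'm t0 hT hL hTh hth f0 A0 fAB hU ha hB.
(* Three discarded vertices would give [B >= 2 * m]. *)
have d2 : (d < 3)%N.
  rewrite ltnNge; apply/negP; rewrite -(ler_nat rat) => d3; nra.
have e0 : 0 <= d%:R :> rat by [].
have e2 : d%:R <= 2 :> rat by rewrite ler_nat.
set e := d%:R in e0 e2 hT hTh hth hB.
(* [T] and [L] are eliminated between [hT], [hL] and [hTh]. *)
have h1 : (m' - e - 3 / 2) * Th <= t * (3 / 2 * (f + U + e) + 4 * A) by nra.
have h2 : t * ((m' - e - 3 / 2) * (1 + 2 * (m' - a - e))) <= (m' - e - 3 / 2) * Th.
  by rewrite mulrCA ler_wpM2l //; lra.
have h3 := le_trans h2 h1; rewrite ler_pM2l // in h3.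
(* The 13 is [1 + 2 * (18 / 3)], from [m' - a >= m / 3]. *)
have h4 : 13 - 2 * e <= 1 + 2 * (m' - a - e) by lra.
have h5 : (m' - e - 3 / 2) * (13 - 2 * e) <= (m' - e - 3 / 2) * (1 + 2 * (m' - a - e)).
  by rewrite ler_wpM2l //; lra.
have {h1 h2 h5} := le_trans h5 h3.
by move: hB; rewrite /e; case: d d2 {hT hTh hth e0 e2 e h4 h3} => [|[|[|]]] // _; lra.
Qed.

Lemma rainbow_sparse (G : sgraph) (m eps q : rat) (n : G -> nat) (c : {set G} -> nat)
    (W : {set G}) (F : {set {set G}}) :
  18 <= m -> 0 <= eps -> eps * #|G|%:R <= 1 / 2 -> 1 <= q ->
  (forall y, \sum_(x | adj y x) share (q ^+ n y) (q ^+ n x) <= m + eps) ->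
  (forall x y, adj x y -> (n x <= n y)%N ->
      (c [set x; y] < updeg n (n x) x + updeg n (n x) y)%N) ->
  F \subset [set e in edges G | e \subset W] -> {in F &, injective c} ->
  (3 <= #|W|)%N ->
  #|F|%:R < m * (#|W|%:R - 2) + 1.
Proof.
move=> m18 eps0 epsG q1 load cP FW inj W3; rewrite ltNge; apply/negP => dense.
have t0 i : 0 < q ^+ i by rewrite exprn_gt0 //; lra.
pose t x := q ^+ n x; have tpos x : 0 < t x by exact: t0.
set m' := m + eps in load.
have W3' : 3 <= #|W|%:R :> rat by rewrite ler_nat.
have WG : #|W|%:R <= #|G|%:R :> rat by rewrite ler_nat max_card.
have epsW : eps * #|W|%:R <= 1 / 2 by nra.
have eps1 : eps <= 1 / 2 by nra.
pose own y := \sum_(x in W | adj y x) share (t y) (t x).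
pose leak y := \sum_(u | adj y u && (u \notin W)) share (t y) (t u).
(* [a y] is what [y] lacks to own [m'] inside [W]; it bounds what [y] owns outside. *)
pose a y := m' - own y.
have loadE y : \sum_(x | adj y x) share (t y) (t x) = own y + leak y.
  by rewrite (bigID (mem W)) /=; congr (_ + _); apply: eq_bigl => x; rewrite andbC.
have leak0 y : 0 <= leak y by apply: sumr_ge0 => u _; apply: share_ge0.
have leak_a y : leak y <= a y by have := load y; rewrite loadE /a; lra.
have a0 y : 0 <= a y by apply: le_trans (leak_a y).
set eW := #|[set e in edges G | e \subset W]|%:R : rat.
pose f := eW - #|F|%:R.
have f0 : 0 <= f by rewrite subr_ge0 ler_nat subset_leq_card.
have sum_a : \sum_(y in W) a y = m' * #|W|%:R - eW.
  rewrite big_split /= sumrN sum_share // card_edges_in -/eW sumr_const -[X in X - _ = _]mulr_natr.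
  by congr (_ - _); field.
(* The slack [eps] adds up to at most 1/2 over [W], and [dense] bounds the rest by [2 * m - 1]. *)
have f_a : f + \sum_(y in W) a y <= 2 * m - 1 / 2 by rewrite sum_a /f /m'; nra.
(* As [3 * lam = 2 * m] exceeds the total in [f_a], at most two vertices lack [lam] or more, and [W]
   has at least three. *)
pose lam := 2 / 3 * m.
have [y0 Wy0 ay0] : exists2 y, y \in W & a y <= lam.
  apply/exists_inP; apply: contraT => /exists_inPn big.
  have : lam * #|W|%:R <= \sum_(y in W) a y.
    rewrite mulr_natr -sumr_const; apply: ler_sum => y Wy.
    by apply: ltW; rewrite ltNge big.
  rewrite /lam; nra.
case: (@arg_maxnP _ y0 [pred y | (y \in W) && (a y <= lam)] n); first by rewrite /= Wy0.
move=> ys /andP[Wys ays] maxys.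
(* Every vertex above [ys] lacks more than [lam], so fewer than 3 are discarded. *)
pose W0 := [set y in W | (n y <= n ys)%N]; pose N := n ys.
have W0W : W0 \subset W by apply/subsetP => y; rewrite inE => /andP[].
have ysW0 : ys \in W0 by rewrite inE Wys leqnn.
have W0N : {in W0, forall x, (n x <= N)%N} by move=> x; rewrite inE => /andP[].
have W0t : {in W0, forall x, t x <= t ys} by move=> x /W0N xN; rewrite ler_weXn2l.
pose d := #|W :\: W0|.
pose own0 y := \sum_(x in W0 | adj y x) share (t y) (t x).
have own0_ge y : m' - a y - d%:R <= own0 y.
  have -> : m' - a y = own y by rewrite /a; lra.
  rewrite lerBlDr.
  rewrite /own (bigID (mem W0)) /= lerD //.
    rewrite le_eqVlt; apply/orP; left; apply/eqP; apply: eq_bigl => x.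
    by case W0x: (x \in W0); rewrite ?andbF //= (subsetP W0W) ?andbT.
  apply: (@le_trans _ _ (\sum_(x in W :\: W0) 1)); last by rewrite sumr_const.
  rewrite [X in _ <= X](bigID (adj y)) /= -[X in X <= _]addr0 lerD ?sumr_ge0 //.
  rewrite [X in _ <= X](eq_bigl (fun x => (x \in W) && adj y x && (x \notin W0))).
    apply: ler_sum => x _; rewrite -(shareD (tpos y) (tpos x)).
    by rewrite lerDl share_ge0.
  by move=> x; rewrite !inE; case: (x \in W); case: (adj y x); rewrite ?andbF ?andbT.
pose U := Num.truncn (2 * m').
have m'0 : 0 <= 2 * m' by rewrite /m'; lra.
(* A neighbour at least as heavy leaves [x] at least half of the edge, so the load of [x] bounds the
   number of these by [2 * m']. *)
have updegU x : (updeg n (n x) x <= U)%N.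
  rewrite truncn_ge_nat // mulrC -ler_pdivrMr //.
  apply: le_trans (load x); rewrite /updeg -sum1_card natr_sum mulr_suml.
  rewrite [X in _ <= X](bigID (fun u => n x <= n u)%N) /= -[X in X <= _]addr0 lerD //; last first.
    by apply: sumr_ge0 => u _; apply: share_ge0.
  rewrite (eq_bigl (fun u => adj x u && (n x <= n u)%N)) => [|u]; last by rewrite inE.
  by apply: ler_sum => u /andP[_ xu]; rewrite mul1r share_ge_half // ler_weXn2l.
pose A := \sum_(y in W0) a y; pose B := \sum_(y in W :\: W0) a y.
have AB : \sum_(y in W) a y = A + B.
  rewrite (bigID (mem W0)) /=; congr (_ + _); apply: eq_bigl => y; rewrite !inE.
    by case: (y \in W).
  by rewrite andbC.
pose Th := \sum_(x in W0) t x.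
pose T := \sum_(x in W0) \sum_(y in W0 | adj x y) Num.min (t x) (t y).
pose L := \sum_(y in W0) \sum_(u | adj y u && (u \notin W)) Num.min (t y) (t u).
apply: (@balance_absurd m m' (t ys) T A B Th L (a ys) f U%:R d).
- exact: m18.
- by rewrite lerDl.
- by rewrite lerD2l.
- exact: tpos.
(* The level inequality is weighted by [jump q k] and summed; terms constant in [k] pick up the
   factor [t ys], the sum of all jumps. *)
- have TE : T / 2 = _ := esym (arcs_level q1 W0N).
  have LE : L = _ := esym (leak_level W q1 W0N).
  have ThE : Th = _ := esym (card_level q W0N).
  rewrite TE LE ThE.
  have -> : t ys = \sum_(k < N.+1) jump q k by rewrite sum_jump.
  rewrite mulr_sumr -!big_split; apply: ler_sum => k _ /=.
  rewrite [X in _ <= X + _ + _]mulrC -!mulrDr ler_wpM2l ?jump_ge0 //.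
  have := card_edges_level k cP updegU FW inj W0W.
  rewrite -(ler_nat rat) !natrD -/eW /f -/d; lra.
- apply: (@le_trans _ _ (\sum_(y in W0) 2 * t ys * a y)); last by rewrite -mulr_sumr.
  apply: ler_sum => y W0y; apply: (@le_trans _ _ (2 * t y * leak y)).
    by rewrite mulr_sumr; apply: ler_sum => u _; apply: min_le_share.
  have := leak_a y; have := leak0 y; have := tpos y; have := W0t y W0y; nra.
- apply: (@le_trans _ _ (\sum_(x in W0) t x * own0 x)).
    apply: (@le_trans _ _ (\sum_(x in W0) ((m' - d%:R) * t x - a x * t ys))).
      by rewrite big_split /= sumrN -mulr_sumr -mulr_suml.
    apply: ler_sum => x W0x.
    have := own0_ge x; have := a0 x; have := tpos x; have := W0t x W0x; nra.
  pose S := \sum_(x in W0) \sum_(y in W0 | adj x y) t x * share (t x) (t y).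
  have -> : \sum_(x in W0) t x * own0 x = S.
    by apply: eq_bigr => x _; rewrite mulr_sumr.
  (* Symmetrising [S] pairs the two shares of each edge, as [wshareD_le] requires. *)
  have : S + S <= 3 / 2 * T.
    rewrite {2}/S sum_adj_sym -big_split mulr_sumr; apply: ler_sum => x _ /=.
    rewrite -big_split mulr_sumr; apply: ler_sum => y _ /=; exact: wshareD_le.
  lra.
(* The neighbours of [ys] in [W0] are no heavier, so [ys] owns exactly [t x / (2 * t ys)] of each
   such edge, and [own0 ys] determines their total weight. *)
- apply: (@le_trans _ _ (t ys + \sum_(x in W0 | adj ys x) t x)).
    rewrite mulrDr mulr1 lerD2l.
    apply: (@le_trans _ _ (t ys * (2 * own0 ys))).
      by rewrite ler_pM2l // ler_pM2l //.
    rewrite !mulr_sumr; apply: ler_sum => x /andP[W0x _].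
    rewrite /share W0t // le_eqVlt; apply/orP; left; apply/eqP.
    by have := tpos ys => tys; field; lra.
  rewrite /Th [X in _ <= X](bigD1 ys) //= lerD2l.
  rewrite [X in _ <= X](bigID (adj ys)) /= -[X in X <= _]addr0 lerD ?sumr_ge0 //; last first.
    by move=> x _; apply: ltW.
  rewrite le_eqVlt; apply/orP; left; apply/eqP; apply: eq_bigl => x.
  case: (x \in W0) => //=; case yx : (adj ys x); rewrite ?andbF ?andbT //.
  by apply/esym; apply: contraTneq yx => ->; rewrite adj_irrefl.
- exact: f0.
- by apply: sumr_ge0.
- by rewrite -addrA -AB.
- by rewrite truncn_le.
- exact: ays.
- rewrite mulr_natr -sumr_const; apply: ler_sum => y; rewrite !inE => /andP[yW0 Wy].
  rewrite Wy /= -ltnNge in yW0; apply: ltW; rewrite ltNge; apply/negP => ay.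
  by have := maxys y; rewrite /= Wy ay => /(_ isT); rewrite leqNgt yW0.
Qed.

(** * From the maximal density to the theorem *)

Lemma max_density_ge (G : sgraph) (W : {set G}) :
  \sum_(x in W) \sum_(y in W | adj x y) 1 <= 2 * max_density G * #|W|%:R.
Proof.
rewrite card_edges_in -mulrA ler_pM2l //.
have [->|W0] := eqVneq W set0.
  rewrite cards0 mulr0 lern0 cards_eq0; apply/eqP/setP => e; rewrite !inE subset0.
  apply/negP => /andP[/edge_ofP[x [y [_ ->]]] /eqP/setP/(_ x)].
  by rewrite !inE eqxx.
rewrite -card_gt0 in W0; rewrite -ler_pdivrMr ?ltr0n //.
pose H : pregraph G := (W, [set e in edges G | e \subset W]).
have sH : subgraph H && (0 < nverts H)%N.
  rewrite /subgraph /nverts W0 andbT; apply/andP; split.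
    by apply/subsetP => e; rewrite inE => /andP[].
  by apply/forall_inP => e; rewrite inE => /andP[].
by rewrite /max_density (bigD1 H) //= le_max lexx.
Qed.

Theorem theorem1p4 (G : sgraph) (hG : 18 <= max_density G) :
  exists c : {set G} -> nat,
    proper_edge_colouring c /\
    (forall H : pregraph G,
       subgraph H -> rainbow c H -> (3 <= nverts H)%N ->
       density2 H < max_density G).
Proof.
(* Small enough for the slack summed over all vertices to be at most 1/2. *)
pose eps : rat := 1 / (2 * (#|G|%:R + 1)).
have v0 : 0 <= #|G|%:R :> rat by [].
have eps0 : 0 < eps by rewrite divr_gt0 //; lra.
have epsG : eps * #|G|%:R <= 1 / 2 by rewrite mulrAC ler_pdivrMr; lra.
have [q [n [q1 load]]] := exists_levels eps0 (@max_density_ge G).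
have [c [proper cP]] := exists_level_colouring n.
exists c; split=> // -[W F] /andP[FE /forall_inP FW] inj W3.
rewrite /density2 /nedges /nverts /= in W3 *.
have W3' : 3 <= #|W|%:R :> rat by rewrite ler_nat.
rewrite ltr_pdivrMr ?ltrBlDr; last lra.
apply: (rainbow_sparse hG (ltW eps0) epsG (ltW q1) load cP) => //.
by apply/subsetP => e Fe; rewrite inE (subsetP FE) // FW.
Qed.
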